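(* Consider a sequence of problems indexed by $n$, with $p=p(n)$, deterministic design matrices $X\in\mathbb{R}^{n\times p}$ and vectors $\beta^*\in\mathbb{R}^p$ with support $S$, $|S|=s=s(n)$. Suppose that we observe $Y=X\beta^*+W$, where each column $X_j$ of $X$ satisfies $\|X_j\|_2^2=n$, and $W\sim N(0,\sigma^2I_{n\times n})$. Assume that there are fixed constants $\epsilon\in(0,1]$ and $C_{\min}>0$ such that for all $n$ $$\left\|X_{S^c}^TX_S(X_S^TX_S)^{-1}\right\|_\infty\le 1-\epsilon\qquad\text{and}\qquad \Lambda_{\min}\left(\tfrac1nX_S^TX_S\right)\ge C_{\min},$$ and define $\rho_n=\min_{i\in S}|\beta^*_i|$. If $\lambda_n\to0$ (with $\lambda_n>0$) is chosen such that $$\text{(a)}\quad \frac{n\lambda_n^2}{\log(p-s)}\to+\infty,\qquad\text{and}\qquad \text{(b)}\quad \frac1{\rho_n}\left\{\sqrt{\frac{\log s}{n}}+\lambda_n\left\|\left(\tfrac1nX_S^TX_S\right)^{-1}\right\|_\infty\right\}\to0,$$ then $\mathbb{P}\left(\mathcal{R}(X,\beta^*,W,\lambda_n)\right)\to1$ as $n\to+\infty$.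
   Context: The support of $\beta^*$ is $S=\{i:\beta^*_i\ne0\}$, $S^c$ is its complement in $\{1,\dots,p\}$. For $T\subseteq\{1,\dots,p\}$, $X_T$ is the $n\times|T|$ matrix whose columns are the columns $X_i$, $i\in T$, of $X$. $\Lambda_{\min}$ denotes the minimal eigenvalue. For a matrix $M$, $\|M\|_\infty=\max_i\sum_j|M_{ij}|$. The noise variance $\sigma^2$ is fixed. The sign function is $\mathrm{sgn}(t)=+1,-1,0$ according to $t>0$, $t<0$, $t=0$, applied elementwise to vectors. Lasso: for $\lambda_n>0$, consider $\min_{\beta\in\mathbb{R}^p}\left\{\frac1{2n}\|Y-X\beta\|_2^2+\lambda_n\|\beta\|_1\right\}$. $\mathcal{R}(X,\beta^*,W,\lambda_n)$ is the event that there exists an optimal solution $\widehat\beta$ of this problem with $\mathrm{sgn}(\widehat\beta)=\mathrm{sgn}(\beta^* )$. *)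

(* Defs.v *)
From HB Require Import structures.
From mathcomp Require Import all_boot all_order all_algebra.
From mathcomp Require Import all_classical all_reals all_analysis.

Set Implicit Arguments.
Unset Strict Implicit.
Unset Printing Implicit Defensive.

Import Order.TTheory GRing.Theory Num.Theory.
Import numFieldNormedType.Exports.

Local Open Scope classical_set_scope.
Local Open Scope ring_scope.

Definition supp (R : realType) (p : nat) (b : 'cV[R]_p) : {set 'I_p} :=
  [set i | b i 0 != 0]%SET.

(* X_T: the columns of X indexed by T, in the order of [enum T]. *)
Definition cols (R : realType) (n p : nat) (X : 'M[R]_(n, p))
    (T : {set 'I_p}) : 'M[R]_(n, #|T|) :=
  colsub (fun k : 'I_#|T| => enum_val k) X.

(* The maximal absolute row sum; it is 0 for a matrix without rows. *)
Definition norm_inf (R : realType) (m k : nat) (M : 'M[R]_(m, k)) : R :=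
  \big[Num.max/0]_(i < m) \sum_(j < k) `|M i j|.

(* Meaningful for a symmetric M of positive size, where the spectrum is finite
   and nonempty, so that the infimum is a minimum.  For an empty spectrum the
   convention [inf set0 = 0] applies. *)
Definition Lambda_min (R : realType) (m : nat) (M : 'M[R]_m) : R :=
  inf [set a | eigenvalue M a].

Definition sqnorm2 (R : realType) (m : nat) (v : 'cV[R]_m) : R :=
  \sum_(i < m) v i 0 ^+ 2.

Definition norm1 (R : realType) (m : nat) (v : 'cV[R]_m) : R :=
  \sum_(i < m) `|v i 0|.

(* A minimum over the finite set [supp b] when b is nonzero. *)
Definition min_abs (R : realType) (p : nat) (b : 'cV[R]_p) : R :=
  inf [set `|b i 0| | i in [set` supp b]].

Definition lasso_obj (R : realType) (n p : nat) (X : 'M[R]_(n, p))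
    (Y : 'cV[R]_n) (lam : R) (b : 'cV[R]_p) : R :=
  (2 * n%:R)^-1 * sqnorm2 (Y - X *m b) + lam * norm1 b.

Definition lasso_optimal (R : realType) (n p : nat) (X : 'M[R]_(n, p))
    (Y : 'cV[R]_n) (lam : R) (bhat : 'cV[R]_p) : Prop :=
  forall b : 'cV[R]_p, lasso_obj X Y lam bhat <= lasso_obj X Y lam b.

(* The property R(X, beta, w, lam), for a realization w of the noise. *)
Definition sign_recovery (R : realType) (n p : nat) (X : 'M[R]_(n, p))
    (beta : 'cV[R]_p) (w : 'cV[R]_n) (lam : R) : Prop :=
  exists bhat : 'cV[R]_p,
    lasso_optimal X (X *m beta + w) lam bhat /\
    map_mx Num.sg bhat = map_mx Num.sg beta.

Definition mutually_independent (R : realType) (d : measure_display)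
    (T : measurableType d) (P : probability T R) (I : finType)
    (W : I -> {RV P >-> R}) : Prop :=
  forall (J : {set I}) (A : I -> set R),
    (forall i, measurable (A i)) ->
    P [set t | forall i, i \in J -> A i (W i t)] =
    (\prod_(i in J) P (W i @^-1` A i))%E.

(* W ~ N(0, sigma^2 I); the second parameter of [normal_prob] is the standard
   deviation. *)
Definition isotropic_gaussian (R : realType) (d : measure_display)
    (T : measurableType d) (P : probability T R) (n : nat) (sigma : R)
    (W : 'I_n -> {RV P >-> R}) : Prop :=
  (forall (i : 'I_n) (A : set R), measurable A ->
     distribution P (W i) A = normal_prob 0 sigma A) /\
  mutually_independent W.

Definition noise_vec (R : realType) (d : measure_display)
    (T : measurableType d) (P : probability T R) (n : nat)
    (W : 'I_n -> {RV P >-> R}) (t : T) : 'cV[R]_n :=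
  \col_(i < n) W i t.

(* Main.v *)
Require Import Defs.
From HB Require Import structures.
From mathcomp Require Import all_boot all_order all_algebra.
From mathcomp Require Import all_classical all_reals all_analysis.
From mathcomp Require Import measurable_realfun ring lra.

Set Implicit Arguments.
Unset Strict Implicit.
Unset Printing Implicit Defensive.

Import Order.TTheory GRing.Theory Num.Theory.
Import numFieldNormedType.Exports.

Local Open Scope classical_set_scope.
Local Open Scope ring_scope.

(** The proof is the primal-dual witness argument.

    By convexity, b minimizes the lasso objective exactly when X^T (Y - X b) is
    n * lam times a subgradient of the l1 norm at b ([lasso_optimalP]).  Once
    the sign pattern is prescribed to be that of beta, these conditions on the
    support S form an invertible linear system, whose only solution is
      u = beta_S + G^-1 (A^T w - n lam sgn beta_S),  A = X_S,  G = A^T A,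
    so that sign recovery becomes a finite list of half-space conditions on the
    noise w: u has the signs of beta_S, and the correlations of the columns
    outside S with the residual are at most n * lam ([sign_recoveryP]).  This
    equivalence plays two roles.  It makes the event measurable, without which
    its probability would carry no information, and it reduces recovery to
    bounds on two linear images of w ([sign_recovery_small_noise]): the shift
    by n lam G^-1 sgn beta_S and the noise G^-1 A^T w must each stay below half
    the smallest coefficient, and outside S the irrepresentability condition
    leaves room n lam eps for the noise.

    Each coordinate of these images is a centred Gaussian of controlled
    variance: sigma^2 (G^-1)_kk <= sigma^2 / (n Cmin) on S, where the smallest
    eigenvalue enters through its Rayleigh quotient ([qform_ge_Lambda_min],
    [invmx_diag_le]), and at most sigma^2 n off S, because the second image
    first projects w orthogonally to the columns of A ([dual_noise_var]).  The
    Chernoff bound ([linear_stat_tail]) and a union bound give the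
    non-asymptotic estimate [sign_recovery_prob]: when lam times the norm of
    (G / n)^-1 is at most rho / 2, the failure probability is at most
      2 s exp (- n rho^2 Cmin / (8 sigma^2))
        + 2 (p - s) exp (- n lam^2 eps^2 / (2 sigma^2)).

    Hypothesis (a) sends the second term to 0.  For the first one, (b) gives
    log s = o(n rho^2), which is not enough when s stays bounded; there one
    uses that the norm of (G / n)^-1 is at least 1 ([norm_inf_invmx_ge1]), so
    that (b) also gives lam = o(rho), while n lam^2 is bounded below by (a). *)

(** * Integrals determined by indicator functions *)

Section change_of_measure.
Context d d' (T : measurableType d) (S : measurableType d') (R : realType).
Import HBNNSimple.
Local Open Scope ereal_scope.

(** An integral identity that holds for indicators extends to nonnegative
    functions by linearity and monotone convergence.  With [h] a density and
    [phi] the identity this is integration against a density; with [h] the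
    remaining factors of a product it is one step of the factorization of
    expectations under independence. *)
Lemma ge0_integral_extend_indic (mu : {measure set T -> \bar R})
    (nu : {measure set S -> \bar R}) (phi : T -> S) (h : T -> R) (c : R)
    (f : S -> R) :
  measurable_fun setT phi -> measurable_fun setT h ->
  (forall t, 0 <= h t)%R -> (0 <= c)%R ->
  (forall A, measurable A ->
     \int[mu]_t (h t * \1_A (phi t))%:E = c%:E * nu A) ->
  measurable_fun setT f -> (forall x, 0 <= f x)%R ->
  \int[mu]_t (h t * f (phi t))%:E = c%:E * \int[nu]_x (f x)%:E.
Proof.
move=> mphi mh h0 c0 hA mf f0.
have mEf : measurable_fun [set: S] (EFin \o f) by exact/measurable_EFinP.
pose g := nnsfun_approx measurableT mEf.
have mg n : measurable_fun setT (fun t => g n (phi t)).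
  by apply: measurableT_comp => //; exact: measurable_funP.
have gE x : (f x)%:E = limn (fun n => (g n x)%:E).
  apply/esym/cvg_lim => //; apply: cvg_nnsfun_approx => // y _.
  by rewrite lee_fin.
have nd_g x : nondecreasing_seq (fun n => (g n x)%:E).
  by move=> a b ab; rewrite lee_fin; exact/lefP/nd_nnsfun_approx.
have -> : \int[mu]_t (h t * f (phi t))%:E =
    limn (fun n => \int[mu]_t (h t * g n (phi t))%:E).
  rewrite -monotone_convergence//=.
  - apply: eq_integral => t _; rewrite EFinM gE -limeMl//.
    exact/ereal_nondecreasing_is_cvgn/nd_g.
  - by move=> n; apply/measurable_EFinP; exact: measurable_funM.
  - by move=> n t _; rewrite lee_fin mulr_ge0.
  - move=> t _ a b ab; rewrite lee_fin ler_wpM2l//.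
    exact/lefP/nd_nnsfun_approx.
have -> : c%:E * \int[nu]_x (f x)%:E =
    limn (fun n => c%:E * \int[nu]_x (g n x)%:E).
  rewrite limeMl//; last first.
    apply/ereal_nondecreasing_is_cvgn => a b ab; apply: ge0_le_integral => //.
    - by move=> x _; rewrite lee_fin.
    - by apply/measurable_EFinP; exact: measurable_funP.
    - by apply/measurable_EFinP; exact: measurable_funP.
    - by move=> x _; exact: nd_g.
  congr (_ * _); rewrite -monotone_convergence//=.
  - by apply: eq_integral => x _; rewrite gE.
  - by move=> n; apply/measurable_EFinP; exact: measurable_funP.
  - by move=> n x _; rewrite lee_fin.
congr (limn _); apply/funext => n.
have ge0r r : r \in range (g n) -> (0 <= r)%R by rewrite inE => -[x _ <-].
have mr r : measurable (g n @^-1` [set r]) by [].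
have gnE x : (g n x)%:E =
    \sum_(r \in range (g n)) (r * \1_(g n @^-1` [set r]) x)%:E.
  by rewrite fsumEFin// -fimfunE.
have mi r : measurable_fun setT (fun t => \1_(g n @^-1` [set r]) (phi t) : R).
  by apply: measurableT_comp => //; exact: measurable_indic.
transitivity (\int[mu]_t (\sum_(r \in range (g n))
    (r%:E * (h t * \1_(g n @^-1` [set r]) (phi t))%:E))).
  apply: eq_integral => t _.
  rewrite EFinM gnE muleC ge0_mule_fsuml; last by move=> r; rewrite EFinM; exact: nnfun_muleindic_ge0.
  by apply: eq_fsbigr => r _; rewrite !EFinM -muleA; congr (_ * _); exact: muleC.
rewrite ge0_integral_fsum//; last 2 first.
- move=> r; apply: emeasurable_funM => //.
  by apply/measurable_EFinP; exact: measurable_funM.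
- move=> r t _; rewrite indicE; have [|_] := boolP (_ \in _).
    rewrite inE /= mulr1 => <-; rewrite mule_ge0// lee_fin//.
  by rewrite mulr0 mule0.
under [in RHS]eq_integral do rewrite gnE.
rewrite ge0_integral_fsum//; last 2 first.
- move=> r; apply/measurable_EFinP; apply: measurable_funM => //.
- by move=> r x _; rewrite EFinM; exact: nnfun_muleindic_ge0.
rewrite muleC ge0_mule_fsuml; last first.
  by move=> r; apply: integral_ge0 => x _; rewrite EFinM; exact: nnfun_muleindic_ge0.
apply: eq_fsbigr => r rg.
rewrite ge0_integralZl//; last 3 first.
- by apply/measurable_EFinP; exact: measurable_funM.
- by move=> t _; rewrite lee_fin mulr_ge0.
- by rewrite lee_fin ge0r.
rewrite hA//.
under [in RHS]eq_integral do rewrite EFinM.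
rewrite integralZl_indic_nnsfun// integral_indic// setIT.
by rewrite muleCA muleC -muleA [nu _ * _]muleC.
Qed.

End change_of_measure.

(** * Independence and Gaussian tails *)

Section independent_product.
Context d (T : measurableType d) (R : realType) (P : probability T R).
Local Open Scope ereal_scope.

(** Independence is given on events only.  The indicators are replaced by
    arbitrary functions one index at a time: the induction is on a set [J] that
    contains every index whose function is not an indicator, and each step is
    an instance of [ge0_integral_extend_indic]. *)
Lemma ge0_integral_prod_independent (I : finType) (W : I -> {RV P >-> R})
    (g : I -> R -> R) :
  mutually_independent W ->
  (forall i, measurable_fun setT (g i)) -> (forall i x, 0 <= g i x)%R ->
  (forall i, \int[P]_t (g i (W i t))%:E < +oo) ->
  \int[P]_t (\prod_i g i (W i t))%:E = \prod_i \int[P]_t (g i (W i t))%:E.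
Proof.
move=> indW.
suff main k : forall (J : {set I}) (g : I -> R -> R), (#|J| <= k)%N ->
    (forall i, measurable_fun setT (g i)) -> (forall i x, 0 <= g i x)%R ->
    (forall i, \int[P]_t (g i (W i t))%:E < +oo) ->
    (forall i, i \notin J -> exists2 A, measurable A & g i = \1_A) ->
    \int[P]_t (\prod_i g i (W i t))%:E = \prod_i \int[P]_t (g i (W i t))%:E.
  move=> mg g0 goo; apply: (main #|I| [set: I]%SET g) => //.
  - by rewrite cardsT.
  - by move=> i; rewrite inE.
elim: k => [|k IH] J {}g Jk mg g0 goo gA.
  move: Jk; rewrite leqn0 cards_eq0 => /eqP J0; subst J.
  have /choice[A AP] i : exists A : set R, measurable A /\ g i = \1_A.
    by have [|A mA gE] := gA i; [rewrite inE|exists A].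
  have mA i : measurable (A i) by case: (AP i).
  have gE i : g i = \1_(A i) by case: (AP i).
  have mWA i : measurable (W i @^-1` A i).
    by rewrite -[X in measurable X]setTI; exact: measurable_funP.
  have prodE t : (\prod_i g i (W i t) =
      \1_[set t | forall i, i \in [set: I]%SET -> A i (W i t)] t)%R.
    rewrite indicE; have [|] := boolP (t \in _).
      rewrite inE /= => tA; apply: big1 => i _.
      by rewrite gE indicE mem_set//; exact: tA.
    rewrite notin_setE /= => tA; apply/eqP; rewrite prodf_seq_eq0.
    apply/hasP; move/existsNP: tA => [i /not_implyP[_ Ai]].
    exists i; first by rewrite mem_index_enum.
    by rewrite /= gE indicE memNset.
  under eq_integral do rewrite prodE.
  have mall : measurable [set t | forall i, i \in [set: I]%SET -> A i (W i t)].
    rewrite (_ : [set _ | _] = \big[setI/setT]_(i : I) (W i @^-1` A i)).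
      by apply: bigsetI_measurable.
    apply/seteqP; split => t /=.
      by move=> tA; rewrite -bigcap_seq => i _ /=; apply: tA; rewrite inE.
    by rewrite -bigcap_seq => tA i _; apply: tA; rewrite /= mem_index_enum.
  rewrite integral_indic// setIT.
  apply: (eq_trans (indW [set: I]%SET A mA)).
  apply: eq_big => i; first by rewrite inE.
  move=> _; rewrite gE.
  transitivity (\int[P]_t (\1_(W i @^-1` A i) t)%:E).
    by rewrite integral_indic// setIT.
  by apply: eq_integral => t _.
have [J0|[j jJ]] := set_0Vmem J.
  by apply: (IH finset.set0) => //; [rewrite cards0|rewrite -J0].
(* The factors other than [j] act as a weight [h], of total mass [c]. *)
pose h t := (\prod_(i | i != j) g i (W i t))%R.
have gfin i : \int[P]_t (g i (W i t))%:E \is a fin_num.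
  by rewrite ge0_fin_numE// integral_ge0// => t _; rewrite lee_fin.
pose c := (\prod_(i | i != j) fine (\int[P]_t (g i (W i t))%:E))%R.
have cE : c%:E = \prod_(i | i != j) \int[P]_t (g i (W i t))%:E.
  rewrite /c -prodEFin; apply: eq_bigr => i _; exact: fineK.
have mgW i : measurable_fun setT (fun t => g i (W i t)).
  by apply: measurableT_comp => //; exact: measurable_funP.
rewrite (bigD1 j)//= -cE muleC.
transitivity (\int[P]_t (h t * g j (W j t))%:E).
  by apply: eq_integral => t _; rewrite (bigD1 j)//= mulrC.
rewrite (@ge0_integral_extend_indic _ _ _ _ _ _ (distribution P (W j)) _ _ c)//.
- rewrite ge0_integral_distribution//; first exact/measurable_EFinP.
  by move=> y; rewrite lee_fin.
- rewrite /h; under eq_fun do rewrite -big_filter.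
  by apply: measurable_prod => i _.
- by move=> t; apply: prodr_ge0.
- by apply: prodr_ge0 => i _; rewrite fine_ge0// integral_ge0// => t _; rewrite lee_fin.
move=> A mA.
(* With an indicator at [j], one index fewer is left to treat. *)
pose g' i := if i == j then \1_A : R -> R else g i.
have mWA : measurable (W j @^-1` A).
  by rewrite -[X in measurable X]setTI; exact: measurable_funP.
have intA : \int[P]_t (\1_A (W j t))%:E = distribution P (W j) A.
  transitivity (\int[P]_t (\1_(W j @^-1` A) t)%:E).
    by apply: eq_integral.
  by rewrite integral_indic// setIT.
have g'j : g' j = \1_A by rewrite /g' eqxx.
have g'i i : i != j -> g' i = g i by move=> /negbTE ij; rewrite /g' ij.
transitivity (\int[P]_t (\prod_i g' i (W i t))%:E).
  apply: eq_integral => t _; rewrite (bigD1 j)//= mulrC g'j.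
  by congr (_ * _)%:E; apply: eq_bigr => i ij; rewrite g'i.
transitivity (\prod_i \int[P]_t (g' i (W i t))%:E); last first.
  rewrite (bigD1 j)//= g'j intA muleC cE; congr (_ * _).
  by apply: eq_bigr => i ij; rewrite g'i.
apply: (IH (J :\ j)%SET).
- by move: Jk; rewrite (cardsD1 j) jJ.
- by move=> i; rewrite /g'; case: ifP => // _; exact: measurable_indic.
- by move=> i x; rewrite /g'; case: ifP => // _; rewrite indicE.
- move=> i; rewrite /g'; case: ifP => // /eqP ->; rewrite intA.
  by rewrite (le_lt_trans (probability_le1 _ _))// ltry.
- move=> i; rewrite !inE /g' negb_and negbK.
  by case: ifP => /= [_ _|ij iJ]; [exists A|exact: gA].
Qed.

End independent_product.

Section gaussian.
Context d (T : measurableType d) (R : realType) (P : probability T R).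

(** Completing the square: exp(a x) times the density of N(0, sigma^2) is
    exp(a^2 sigma^2 / 2) times the density of N(a sigma^2, sigma^2). *)
Lemma gaussian_mgf (X : {RV P >-> R}) (sigma a : R) : 0 < sigma ->
  (forall A : set R, measurable A ->
     distribution P X A = normal_prob 0 sigma A) ->
  (\int[P]_t (expR (a * X t))%:E = (expR (a ^+ 2 * sigma ^+ 2 / 2))%:E)%E.
Proof.
move=> s0 dX.
have s1 : sigma != 0 by rewrite gt_eqF.
have mexp : measurable_fun [set: R] (fun x => expR (a * x)).
  by apply: measurableT_comp => //; exact: measurable_funM.
have e0 (x : R) : 0 <= expR (a * x) by exact: expR_ge0.
transitivity (\int[distribution P X]_x (expR (a * x))%:E)%E.
  rewrite ge0_integral_distribution//; exact/measurable_EFinP.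
(* The Lebesgue measure and the law of [X] live on two measurable structures
   on [R] with the same sets; the identity [idR] goes from one to the other. *)
pose idR : measurableTypeR R -> R := idfun.
have midR : measurable_fun setT idR by move=> _ B mB; rewrite setTI.
have := @ge0_integral_extend_indic _ _ (measurableTypeR R) R R
  lebesgue_measure (distribution P X) idR (normal_pdf 0 sigma) 1
  (fun x => expR (a * x)).
rewrite mul1e => <- //; last 3 first.
- exact: measurable_normal_pdf.
- by move=> x; exact: normal_pdf_ge0.
- move=> A mA; rewrite mul1e; apply: (eq_trans _ (esym (dX A mA))).
  rewrite /normal_prob [in RHS]integral_mkcond.
  apply: eq_integral => x _; rewrite patchE indicE.
  by case: ifP => xA; rewrite ?mulr1 ?mulr0.
transitivity (\int[lebesgue_measure]_x ((expR (a ^+ 2 * sigma ^+ 2 / 2))%:E *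
    (normal_pdf (a * sigma ^+ 2) sigma x)%:E))%E.
  apply: eq_integral => x _; rewrite -EFinM; congr EFin.
  rewrite !normal_pdfE// [RHS]mulrCA -[LHS]mulrA; congr (_ * _).
  rewrite /normal_fun -!expRD; congr expR.
  by rewrite /idR /=; field.
rewrite ge0_integralZl//.
- by rewrite integral_normal_pdf mule1.
- by apply/measurable_EFinP; exact: measurable_normal_pdf.
- by move=> x _; rewrite lee_fin normal_pdf_ge0.
Qed.

Definition linear_stat n (W : 'I_n -> {RV P >-> R}) (a : 'I_n -> R) (t : T) : R :=
  \sum_i a i * W i t.

Lemma measurable_linear_stat n (W : 'I_n -> {RV P >-> R}) (a : 'I_n -> R) :
  measurable_fun setT (linear_stat W a).
Proof.
by apply: measurable_sum => i; apply: measurable_funM.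
Qed.

Lemma linear_stat_mgf n (W : 'I_n -> {RV P >-> R}) (sigma : R) (a : 'I_n -> R) :
  0 < sigma -> isotropic_gaussian sigma W ->
  (\int[P]_t (expR (linear_stat W a t))%:E =
     (expR ((\sum_i a i ^+ 2) * sigma ^+ 2 / 2))%:E)%E.
Proof.
move=> s0 [dW indW].
transitivity (\int[P]_t (\prod_i expR (a i * W i t))%:E)%E.
  by apply: eq_integral => t _; rewrite /linear_stat expR_sum.
rewrite (@ge0_integral_prod_independent _ _ _ _ _ _ (fun i x => expR (a i * x)))//.
- transitivity (\prod_i (expR (a i ^+ 2 * sigma ^+ 2 / 2))%:E)%E.
    by apply: eq_bigr => i _; apply: gaussian_mgf => //; exact: dW.
  by rewrite prodEFin -expR_sum -!mulr_suml.
- by move=> i; apply: measurableT_comp => //; exact: measurable_funM.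
- by move=> i; rewrite (@gaussian_mgf _ sigma) ?ltry//; exact: dW.
Qed.

Lemma linear_stat_upper_tail n (W : 'I_n -> {RV P >-> R}) (sigma v u : R)
    (a : 'I_n -> R) :
  0 < sigma -> isotropic_gaussian sigma W -> 0 < v -> 0 < u ->
  \sum_i a i ^+ 2 <= v ->
  (P [set t | (u <= linear_stat W a t)%R] <=
     (expR (- (u ^+ 2 / (2 * sigma ^+ 2 * v))))%:E)%E.
Proof.
move=> s0 gW v0 u0 av.
have mX := measurable_linear_stat W a.
pose X : {RV P >-> R} := mfun_Sub (mem_set mX).
(* This rate minimizes the Chernoff exponent r^2 sigma^2 v / 2 - r u. *)
pose r := u / (sigma ^+ 2 * v).
have r0 : 0 < r by rewrite divr_gt0// mulr_gt0// exprn_gt0.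
have := chernoff X u r0.
rewrite /mmt_gen_fun unlock /=.
have -> : (\int[P]_w (expR (X w * r))%:E)%E =
    (expR ((\sum_i (r * a i) ^+ 2) * sigma ^+ 2 / 2))%:E.
  rewrite -(@linear_stat_mgf n W)//; apply: eq_integral => t _.
  rewrite /X /linear_stat /= mulr_suml; congr (expR _)%:E.
  by apply: eq_bigr => i _; ring.
move=> /le_trans; apply; rewrite -EFinM lee_fin -expRD ler_expR.
under eq_bigr do rewrite exprMn.
rewrite -mulr_sumr.
apply: (@le_trans _ _ (r ^+ 2 * v * sigma ^+ 2 / 2 - r * u)).
  by rewrite lerD2r ler_pM2r// ler_wpM2r ?sqr_ge0// ler_wpM2l ?sqr_ge0.
by rewrite /r le_eqVlt; apply/orP; left; apply/eqP; field; rewrite !gt_eqF.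
Qed.

Lemma linear_stat_tail n (W : 'I_n -> {RV P >-> R}) (sigma v u : R)
    (a : 'I_n -> R) :
  0 < sigma -> isotropic_gaussian sigma W -> 0 < v -> 0 < u ->
  \sum_i a i ^+ 2 <= v ->
  (P [set t | (u <= `|linear_stat W a t|)%R] <=
     (2 * expR (- (u ^+ 2 / (2 * sigma ^+ 2 * v))))%:E)%E.
Proof.
move=> s0 gW v0 u0 av.
have mge b : measurable [set t | u <= linear_stat W b t].
  rewrite -[X in measurable X]setTI.
  by apply: measurable_fun_le => //; exact: measurable_linear_stat.
have -> : [set t | u <= `|linear_stat W a t|] =
   [set t | u <= linear_stat W a t] `|`
   [set t | u <= linear_stat W (fun i => - a i) t].
  apply/seteqP; split => t /=; rewrite /linear_stat.
    rewrite ler_normr => /orP[?|ut]; [by left|right].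
    by rewrite (eq_bigr (fun i => - (a i * W i t))) ?sumrN// => i _; rewrite mulNr.
  rewrite ler_normr (eq_bigr (fun i => - (a i * W i t)) (F1 := fun i => - a i * _)).
    by rewrite sumrN; case => ->; rewrite ?orbT.
  by move=> i _; rewrite mulNr.
rewrite (le_trans (measureU2 _ (mge _) (mge _)))//.
rewrite mulr_natl mulr2n EFinD leeD//; apply: linear_stat_upper_tail => //.
by under eq_bigr do rewrite sqrrN.
Qed.

End gaussian.

(** * Rayleigh quotients and the smallest eigenvalue *)

Section small_perturbations.
Context (R : realType).

Lemma le0_of_small (a C e : R) : 0 < e ->
  (forall t, 0 < t <= e -> a * t <= C * t ^+ 2) -> a <= 0.
Proof.
move=> e0 small; rewrite leNgt; apply/negP => a0.
have k0 : 0 < 2 * (`|C| + 1) by rewrite mulr_gt0// ltr_wpDl.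
(* At this [t] the quadratic term is at most half of [a * t]. *)
pose t := Num.min e (a / (2 * (`|C| + 1))).
have t0 : 0 < t by rewrite lt_min e0 divr_gt0.
have /small : 0 < t <= e by rewrite t0 ge_min lexx.
rewrite expr2 mulrA ler_pM2r// leNgt => /negP; apply.
have te : t * (2 * (`|C| + 1)) <= a.
  by rewrite -ler_pdivlMr// ge_min lexx orbT.
have := ler_norm C; nra.
Qed.

Lemma eq0_of_small (a C e : R) : 0 < e ->
  (forall t, `|t| <= e -> a * t <= C * t ^+ 2) -> a = 0.
Proof.
move=> e0 small; apply/eqP; rewrite eq_le; apply/andP; split.
  apply: (le0_of_small e0) => t /andP[t0 te]; apply: small.
  by rewrite gtr0_norm.
rewrite -oppr_le0; apply: (le0_of_small e0 (C := C)) => t /andP[t0 te].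
by rewrite mulNr -mulrN -(sqrrN t) small// normrN gtr0_norm.
Qed.

End small_perturbations.

Section rayleigh.
Context (R : realType).

Definition qform m (M : 'M[R]_m) (x : 'rV[R]_m) : R := (x *m M *m x^T) 0 0.
Definition sqnormr m (x : 'rV[R]_m) : R := \sum_i x 0 i ^+ 2.

Lemma sqnormrE m (x : 'rV[R]_m) : sqnormr x = (x *m x^T) 0 0.
Proof. by rewrite mxE; apply: eq_bigr => i _; rewrite mxE expr2. Qed.

Lemma sqnormr_ge0 m (x : 'rV[R]_m) : 0 <= sqnormr x.
Proof. by apply: sumr_ge0 => i _; exact: sqr_ge0. Qed.

Lemma sqnormr_eq0 m (x : 'rV[R]_m) : sqnormr x = 0 -> x = 0.
Proof.
move=> /eqP; rewrite psumr_eq0 => [/allP x0|i _]; last exact: sqr_ge0.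
apply/rowP => i; rewrite !mxE; apply/eqP.
by rewrite -sqrf_eq0; apply: x0; rewrite mem_index_enum.
Qed.

Lemma ler_sqr_sqnormr m (x : 'rV[R]_m) i : x 0 i ^+ 2 <= sqnormr x.
Proof.
rewrite /sqnormr (bigD1 i)//= lerDl.
by apply: sumr_ge0 => j _; exact: sqr_ge0.
Qed.

Lemma qformZ m (M : 'M[R]_m) a x : qform M (a *: x) = a ^+ 2 * qform M x.
Proof.
by rewrite /qform -scalemxAl linearZ/= -scalemxAr -scalemxAl scalerA mxE expr2.
Qed.

Lemma sqnormrZ m a (x : 'rV[R]_m) : sqnormr (a *: x) = a ^+ 2 * sqnormr x.
Proof. by rewrite /sqnormr mulr_sumr; apply: eq_bigr => i _; rewrite mxE exprMn. Qed.

Lemma qformDZ m (M : 'M[R]_m) x y t : M^T = M ->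
  qform M (x + t *: y) =
  qform M x + 2 * t * (x *m M *m y^T) 0 0 + t ^+ 2 * qform M y.
Proof.
move=> sM; rewrite -qformZ.
have cross : (x *m M *m (t *: y)^T) 0 0 = t * (x *m M *m y^T) 0 0.
  by rewrite linearZ/= -scalemxAr mxE.
have cross' : (t *: y *m M *m x^T) 0 0 = t * (x *m M *m y^T) 0 0.
  rewrite -cross (_ : t *: y *m M *m x^T = (x *m M *m (t *: y)^T)^T) ?mxE//.
  by rewrite !trmx_mul trmxK sM mulmxA.
have add00 (B C : 'M[R]_1) : (B + C) 0 0 = B 0 0 + C 0 0 by rewrite mxE.
rewrite /qform linearD/= !mulmxDl !mulmxDr !add00 cross cross'.
by ring.
Qed.

Lemma continuous_sum_fun (T : topologicalType) (I : Type) (r : seq I)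
    (F : I -> T -> R) :
  (forall i, continuous (F i)) -> continuous (fun x => \sum_(i <- r) F i x).
Proof. by move=> cF; apply: continuous_big => //; exact: add_continuous. Qed.

Lemma continuous_qform m (M : 'M[R]_m) : continuous (qform M).
Proof.
have -> : qform M = fun x => \sum_i (\sum_j x 0 j * M j i) * x 0 i.
  by apply/funext => x; rewrite /qform mxE; apply: eq_bigr => i _; rewrite !mxE.
have cc i : continuous (fun x : 'rV[R]_m => x 0 i) by exact: coord_continuous.
apply: continuous_sum_fun => i x; apply: (continuousM _ (cc i x)); move: x.
by apply: continuous_sum_fun => j x; apply: (continuousM (cc j x)); exact: cst_continuous.
Qed.

(** The minimum [mu] of the quadratic form on the unit sphere exists by
    compactness, and perturbing a minimizer along each coordinate shows that it
    is an eigenvector for [mu]; hence the least eigenvalue is at most [mu]. *)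
Lemma qform_ge_Lambda_min m (M : 'M[R]_m) (x : 'rV[R]_m) : M^T = M ->
  Lambda_min M * sqnormr x <= qform M x.
Proof.
move=> sM; case: m => [|m] in M x sM *.
  by rewrite [x]thinmx0 /qform /sqnormr big_ord0 mulr0 mul0mx mul0mx mxE.
pose A := [set x : 'rV[R]_m.+1 | sqnormr x = 1].
have A0 : A !=set0.
  exists (delta_mx 0 0); rewrite /A/= /sqnormr (bigD1 ord0)//= big1.
    by rewrite mxE eqxx /= expr1n addr0.
  by move=> i /negbTE i0; rewrite mxE i0 andbF expr0n.
have cA : compact A.
  apply: bounded_closed_compact.
    exists 1; split; first exact: num_real.
    move=> y y1 z zA /=.
    rewrite (le_trans _ (ltW y1))// [leLHS]mx_normrE.
    apply: bigmax_le => // -[i j] _ /=; rewrite ord1.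
    rewrite -(@ler_pXn2r _ 2)// ?nnegrE// expr1n -normrX ger0_norm ?sqr_ge0//.
    by rewrite -zA ler_sqr_sqnormr.
  rewrite (_ : A = qform 1%:M @^-1` [set 1]).
    by apply: closed_comp => [y _|]; [exact: continuous_qform|exact: closed_eq].
  by apply/seteqP; split => y /=; rewrite /A/= /qform mulmx1 sqnormrE.
have [u /[!inE] uA minu] := compact_EVT_min A0 cA
  (continuous_subspaceT (@continuous_qform _ M)).
pose mu := qform M u.
have rq y : mu * sqnormr y <= qform M y.
  have [y0|y0] := eqVneq (sqnormr y) 0.
    rewrite y0 mulr0 (sqnormr_eq0 y0) -(scale0r y) qformZ expr2 !mul0r//.
  have yp : 0 < sqnormr y by rewrite lt_neqAle eq_sym y0 sqnormr_ge0.
  pose a := (Num.sqrt (sqnormr y))^-1.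
  have a2 : a ^+ 2 = (sqnormr y)^-1 by rewrite exprVn sqr_sqrtr// ltW.
  have : a *: y \in A by rewrite inE /A/= sqnormrZ a2 mulVf.
  by move=> /minu; rewrite qformZ a2 mulrC ler_pdivlMr.
have uM : u *m M = mu *: u.
  apply/rowP => i; apply/eqP; rewrite -subr_eq0; apply/eqP.
  pose y : 'rV[R]_m.+1 := delta_mx 0 i.
  have ent (z : 'rV[R]_m.+1) : (z *m y^T) 0 0 = z 0 i.
    by rewrite trmx_delta -colE mxE.
  apply: (@eq0_of_small _ _ ((qform M y - mu * sqnormr y) / 2) 1) => // t _.
  have := rq (u - t *: y).
  rewrite -scaleNr qformDZ// (_ : sqnormr (u + - t *: y) =
    sqnormr u + 2 * (- t) * u 0 i + t ^+ 2 * sqnormr y); last first.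
    have := @qformDZ _ 1%:M u y (- t) (trmx1 _ _).
    by rewrite /qform !mulmx1 -!sqnormrE ent sqrrN.
  by rewrite ent uA !mxE -/mu sqrrN; lra.
have mu_eig : [set a | eigenvalue M a] mu.
  apply/eigenvalueP; exists u => //; apply/eqP => u0.
  by move/eqP: uA; rewrite u0 sqnormrE mul0mx mxE eq_sym oner_eq0.
have : Lambda_min M <= mu.
  apply: ge_inf => //; exists mu => a /eigenvalueP[v vM v0].
  have qv : qform M v = a * sqnormr v.
    by rewrite /qform vM -scalemxAl mxE -sqnormrE.
  have := rq v; rewrite qv ler_pM2r//.
  rewrite lt_neqAle sqnormr_ge0 andbT eq_sym.
  by apply/eqP => /sqnormr_eq0/eqP; rewrite (negbTE v0).
by move=> le_mu; rewrite (le_trans _ (rq x))// ler_wpM2r// sqnormr_ge0.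
Qed.

Section positive.
Context (m : nat) (M : 'M[R]_m) (c : R).
Hypotheses (sM : M^T = M) (c0 : 0 < c) (cM : c <= Lambda_min M).

Let qform_ge x : c * sqnormr x <= qform M x.
Proof.
rewrite (le_trans _ (qform_ge_Lambda_min x sM))//.
by rewrite ler_wpM2r// sqnormr_ge0.
Qed.

Lemma unitmx_Lambda_min : M \in unitmx.
Proof.
rewrite -row_free_unit; apply: inj_row_free => v vM.
have := qform_ge v; rewrite /qform vM mul0mx mxE pmulr_rle0// => v0.
by apply/sqnormr_eq0/eqP; rewrite eq_le v0 sqnormr_ge0.
Qed.

(** The k-th row x of the inverse satisfies x M x^T = x_k, so the Rayleigh bound
    reads c |x|^2 <= x_k, and |x|^2 is at least x_k^2. *)
Lemma invmx_diag_le k : invmx M k k <= c^-1.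
Proof.
have xE : qform M (row k (invmx M)) = invmx M k k.
  by rewrite /qform -row_mul mulVmx ?unitmx_Lambda_min// row1 -rowE !mxE.
have := qform_ge (row k (invmx M)); rewrite xE => le1.
have := ler_sqr_sqnormr (row k (invmx M)) k; rewrite mxE => le2.
have [le0|gt0] := leP (invmx M k k) 0.
  by rewrite (le_trans le0)// invr_ge0 ltW.
rewrite -[c^-1]mul1r ler_pdivlMr// -(ler_pM2r gt0) mul1r mulrAC mulrC.
by apply: le_trans le1; rewrite ler_pM2l.
Qed.

(** In size 0 the spectrum is empty, and the infimum of the empty set is 0. *)
Lemma size_gt0_Lambda_min : (0 < m)%N.
Proof.
rewrite lt0n; apply/eqP => m0.
move: cM; rewrite /Lambda_min (_ : [set a | _] = set0) ?inf0.
  by rewrite leNgt c0.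
apply/seteqP; split => // a /= /eigenvalueP[v _ /eqP]; apply.
by apply/rowP => i; have := ltn_ord i; rewrite [X in (_ < X)%N]m0.
Qed.

End positive.

End rayleigh.

(** * Optimality conditions for the lasso *)

Section subgradient.
Context (R : realType).

(** [g] belongs to the subdifferential of [m * `|.|] at [h]. *)
Definition abs_subgradient (m h g : R) : Prop :=
  if h == 0 then is_true (`|g| <= m) else g = m * Num.sg h.

Lemma abs_subgradient_le (m h g b : R) : 0 <= m -> abs_subgradient m h g ->
  g * (b - h) <= m * (`|b| - `|h|).
Proof.
rewrite /abs_subgradient => m0; case: eqP => [->|_] gE.
  rewrite normr0 !subr0 (le_trans (ler_norm _))// normrM.
  by rewrite ler_wpM2r.
rewrite gE -mulrA ler_wpM2l// mulrBr -normrEsg lerD2r.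
rewrite (le_trans (ler_norm _))// normrM ler_piMl//.
by rewrite normr_sg; case: (h != 0).
Qed.

(** A smooth error term of order t^2 does not change first-order conditions.
    This is how optimality along a coordinate axis is exploited, the quadratic
    term being that of the least squares part. *)
Lemma abs_subgradient_of_quadratic (m h g C : R) :
  (forall t, g * t <= C * t ^+ 2 + m * (`|h + t| - `|h|)) ->
  abs_subgradient m h g.
Proof.
rewrite /abs_subgradient => gC; case: eqP => [h0|/eqP h0].
  (* The two one-sided derivatives at the kink, [e] being 1 or -1. *)
  have one_sided (e : R) : `|e| = 1 -> g * e <= m.
    move=> e1; rewrite -subr_le0; apply: (@le0_of_small _ _ C 1) => // t /andP[t0 _].
    have := gC (e * t); rewrite h0 add0r normr0 subr0 normrM e1 mul1r.
    have e2 : e ^+ 2 = 1 by rewrite -real_normK ?num_real// e1 expr1n.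
    by rewrite (gtr0_norm t0) exprMn e2 mul1r mulrBl mulrA; lra.
  rewrite ler_norml lerNl -mulrN1 one_sided ?normrN1//=.
  by rewrite -[g]mulr1 one_sided// normr1.
apply/eqP; rewrite -subr_eq0; apply/eqP.
apply: (@eq0_of_small _ _ C `|h|); first by rewrite normr_gt0.
move=> t th; suff ht : `|h + t| - `|h| = Num.sg h * t.
  by have := gC t; rewrite ht mulrBl -mulrA; lra.
move: th; have [hp|hn|h00] := ltrgt0P h; last by rewrite h00 eqxx in h0.
  rewrite gtr0_sg// mul1r ler_norml => /andP[th _].
  by rewrite ger0_norm; lra.
rewrite ltr0_sg// ler_norml => /andP[_ th].
by rewrite ler0_norm; lra.
Qed.

End subgradient.

Section lasso_kkt.
Context (R : realType) (n p : nat).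
Variables (X : 'M[R]_(n, p)) (Y : 'cV[R]_n) (lam : R).
Hypotheses (n0 : (0 < n)%N) (lam0 : 0 <= lam).
Implicit Types b h : 'cV[R]_p.

Lemma sqnorm2_ge0 m (v : 'cV[R]_m) : 0 <= sqnorm2 v.
Proof. by apply: sumr_ge0 => i _; exact: sqr_ge0. Qed.

Lemma sqnorm2B m (u v : 'cV[R]_m) :
  sqnorm2 (u - v) = sqnorm2 u - 2 * (u^T *m v) 0 0 + sqnorm2 v.
Proof.
rewrite /sqnorm2 mxE mulr_sumr -sumrB -big_split; apply: eq_bigr => i _ /=.
by rewrite !mxE; ring.
Qed.

(** Minus n times the gradient of the least squares part of the objective. *)
Definition lasso_corr h : 'cV[R]_p := X^T *m (Y - X *m h).

Lemma lasso_objB b h :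
  lasso_obj X Y lam b - lasso_obj X Y lam h =
  n%:R^-1 * (sqnorm2 (X *m (b - h)) / 2 +
    \sum_j (n%:R * lam * (`|b j 0| - `|h j 0|) -
            lasso_corr h j 0 * (b j 0 - h j 0))).
Proof.
have n1 : n%:R != 0 :> R by rewrite pnatr_eq0 -lt0n.
rewrite /lasso_obj.
have -> : Y - X *m b = (Y - X *m h) - X *m (b - h).
  by rewrite mulmxBr opprB addrA subrK.
rewrite sqnorm2B sumrB -mulr_sumr sumrB.
have -> : ((Y - X *m h)^T *m (X *m (b - h))) 0 0 =
    \sum_j lasso_corr h j 0 * (b j 0 - h j 0).
  rewrite mulmxA -[X in _^T *m X]trmxK -trmx_mul mxE; apply: eq_bigr => j _.
  by rewrite !mxE.
rewrite /norm1; move: (sqnorm2 _) (sqnorm2 _) (\sum_j _) (\sum_j _) (\sum_j _).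
by move=> *; field.
Qed.

(** The Karush-Kuhn-Tucker conditions.  Sufficiency adds the subgradient
    inequalities of the coordinates; necessity compares [h] with its
    perturbations along each coordinate axis. *)
Lemma lasso_optimalP h : lasso_optimal X Y lam h <->
  forall j, abs_subgradient (n%:R * lam) (h j 0) (lasso_corr h j 0).
Proof.
have nlam0 : 0 <= n%:R * lam by rewrite mulr_ge0.
have ni0 : 0 < n%:R^-1 :> R by rewrite invr_gt0 ltr0n.
split=> [opt j|sub b]; last first.
  rewrite -subr_ge0 lasso_objB mulr_ge0 ?invr_ge0// addr_ge0 ?divr_ge0 ?sqnorm2_ge0//.
  by apply: sumr_ge0 => j _; rewrite subr_ge0 abs_subgradient_le.
pose e : 'cV[R]_p := delta_mx j 0.
apply: (@abs_subgradient_of_quadratic _ _ _ _ (sqnorm2 (X *m e) / 2)) => t.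
have := opt (h + t *: e); rewrite -subr_ge0 lasso_objB pmulr_rge0//.
rewrite addrAC subrr add0r -scalemxAr.
have -> : sqnorm2 (t *: (X *m e)) = t ^+ 2 * sqnorm2 (X *m e).
  by rewrite /sqnorm2 mulr_sumr; apply: eq_bigr => i _; rewrite mxE exprMn.
rewrite (bigD1 j)//= big1 => [|i /negbTE ij].
  by rewrite !mxE !eqxx mulr1 addr0 (addrC (h j 0)) addrK; lra.
by rewrite !mxE ij /= mulr0 addr0 !subrr !mulr0 subrr.
Qed.

End lasso_kkt.

(** * The primal-dual witness *)

Section coordinate_subsets.
Context (R : realType) (n p : nat).
Implicit Types (T : {set 'I_p}) (b : 'cV[R]_p).

Definition subvec T b : 'cV[R]_#|T| := rowsub (fun k : 'I_#|T| => enum_val k) b.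

Definition extvec T (u : 'cV[R]_#|T|) : 'cV[R]_p :=
  \col_j \sum_(k | enum_val k == j) u k 0.

Lemma extvecK T (u : 'cV[R]_#|T|) : subvec T (extvec u) = u.
Proof.
apply/colP => k; rewrite !mxE (big_pred1 k)// => l.
by rewrite (inj_eq enum_val_inj).
Qed.

Lemma extvec_out T (u : 'cV[R]_#|T|) j : j \notin T -> extvec u j 0 = 0.
Proof.
move=> jT; rewrite mxE big_pred0// => k.
by apply/negP => /eqP kj; rewrite -kj enum_valP in jT.
Qed.

Lemma tr_cols_mul (X : 'M[R]_(n, p)) T (r : 'cV[R]_n) :
  (cols X T)^T *m r = subvec T (X^T *m r).
Proof.
by apply/colP => k; rewrite !mxE; apply: eq_bigr => i _; rewrite !mxE.
Qed.

Lemma mul_cols_subvec (X : 'M[R]_(n, p)) T b :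
  (forall j, j \notin T -> b j 0 = 0) -> X *m b = cols X T *m subvec T b.
Proof.
move=> bT; apply/colP => i; rewrite !mxE (bigID (mem T))/= [X in _ + X]big1.
  by rewrite addr0 big_enum_val; apply: eq_bigr => k _; rewrite !mxE.
by move=> j jT; rewrite bT// mulr0.
Qed.

End coordinate_subsets.

Section primal_dual_witness.
Context (R : realType) (n p : nat).
Variables (X : 'M[R]_(n, p)) (beta : 'cV[R]_p) (lam : R).
Let S := supp beta.
Let A := cols X S.
Let B := cols X (~: S)%SET.
Let G := A^T *m A.
Let bS := subvec S beta.
Let zS : 'cV[R]_#|S| := map_mx Num.sg bS.
Hypotheses (n0 : (0 < n)%N) (lam0 : 0 <= lam) (uG : G \in unitmx).

(** The restriction to the support of the only candidate for a lasso solution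
    with the signs of [beta]: it solves the stationarity equations on the
    support, with the subgradient set to the signs of [beta]. *)
Definition primal_witness (w : 'cV[R]_n) : 'cV[R]_#|S| :=
  bS + invmx G *m (A^T *m w - (n%:R * lam) *: zS).

(** The correlations of the columns outside the support with the residual of
    the candidate solution. *)
Definition dual_witness (w : 'cV[R]_n) : 'cV[R]_#|~: S| :=
  B^T *m (w - A *m (primal_witness w - bS)).

Let beta_out j : j \notin S -> beta j 0 = 0.
Proof. by rewrite inE negbK => /eqP. Qed.

Let bS_neq0 k : bS k 0 != 0.
Proof. by rewrite mxE; have := enum_valP k; rewrite inE. Qed.

Let residualE w (h : 'cV[R]_p) : (forall j, j \notin S -> h j 0 = 0) ->
  X *m beta + w - X *m h = w - A *m (subvec S h - bS).
Proof.
move=> hS; rewrite (mul_cols_subvec X beta_out) (mul_cols_subvec X hS).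
by rewrite mulmxBr opprB addrCA addrA.
Qed.

(** A lasso solution with the signs of [beta] vanishes outside the support and
    is determined on the support by the stationarity equations, since the Gram
    matrix is invertible; what remains of optimality is the sign pattern and
    the bound on the correlations outside the support. *)
Lemma sign_recoveryP w : sign_recovery X beta w lam <->
  (forall k, Num.sg (primal_witness w k 0) = Num.sg (bS k 0)) /\
  (forall j, `|dual_witness w j 0| <= n%:R * lam).
Proof.
have corrE h j : lasso_corr X (X *m beta + w) h j 0 =
    (X^T *m (X *m beta + w - X *m h)) j 0 by [].
have onS (r : 'cV[R]_n) k : (X^T *m r) (enum_val k) 0 = (A^T *m r) k 0.
  by rewrite tr_cols_mul [RHS]mxE.
have onSc (r : 'cV[R]_n) (k : 'I_#|~: S|) :
    (X^T *m r) (enum_val k) 0 = (B^T *m r) k 0.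
  by rewrite tr_cols_mul [RHS]mxE.
split=> [[h [/(lasso_optimalP _ _ n0 lam0) opt sgE]]|[sgP dualP]].
  have hsg j : Num.sg (h j 0) = Num.sg (beta j 0).
    by have /colP/(_ j) := sgE; rewrite !mxE.
  have hS j : j \notin S -> h j 0 = 0.
    by move=> jS; apply/eqP; rewrite -sgr_eq0 hsg beta_out// sgr0.
  have hS0 (k : 'I_#|S|) : h (enum_val k) 0 != 0.
    by rewrite -sgr_eq0 hsg sgr_eq0; have := enum_valP k; rewrite inE.
  have AT : A^T *m (w - A *m (subvec S h - bS)) = (n%:R * lam) *: zS.
    apply/colP => k; rewrite -onS -residualE// -corrE.
    have := opt (enum_val k); rewrite /abs_subgradient (negbTE (hS0 k)) => ->.
    by rewrite hsg !mxE.
  have hE : subvec S h = primal_witness w.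
    have GE : A^T *m w - (n%:R * lam) *: zS = G *m (subvec S h - bS).
      by rewrite -AT mulmxBr subKr mulmxA.
    by rewrite /primal_witness GE mulKmx// addrC subrK.
  split=> [k|k]; first by rewrite -hE !mxE hsg.
  rewrite /dual_witness -hE -onSc -residualE// -corrE.
  have := opt (enum_val k); rewrite /abs_subgradient hS ?eqxx//.
  by have := enum_valP k; rewrite inE.
exists (extvec (primal_witness w)).
have hS j : j \notin S -> extvec (primal_witness w) j 0 = 0.
  by move=> jS; rewrite extvec_out.
have hval k : extvec (primal_witness w) (enum_val k) 0 = primal_witness w k 0.
  by rewrite -[in RHS](extvecK (primal_witness w)) [RHS]mxE.
have onTo (T : {set 'I_p}) j : j \in T -> exists k : 'I_#|T|, j = enum_val k.
  by move=> jT; exists (enum_rank_in jT j); rewrite enum_rankK_in.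
split; last first.
  apply/colP => j; rewrite [LHS]mxE [RHS]mxE.
  have [jS|jS] := boolP (j \in S); last by rewrite hS// beta_out.
  by have [k ->] := onTo _ _ jS; rewrite hval sgP mxE.
apply/(lasso_optimalP _ _ n0 lam0) => j; rewrite corrE residualE// extvecK.
rewrite /abs_subgradient; have [jS|jS] := boolP (j \in S).
  have [k ->] := onTo _ _ jS; rewrite hval -sgr_eq0 sgP sgr_eq0.
  rewrite (negbTE (bS_neq0 k)) onS /primal_witness addrAC subrr add0r.
  rewrite mulmxBr mulmxA -/G mulKVmx// subKr.
  by rewrite !mxE.
rewrite hS// eqxx; have [|k ->] := onTo (~: S)%SET j; first by rewrite inE.
by rewrite onSc; exact: dualP.
Qed.

(** The linear parts of the two witnesses, as functions of the noise. *)
Definition primal_noise : 'M[R]_(#|S|, n) := invmx G *m A^T.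
Definition dual_noise : 'M[R]_(#|~: S|, n) := B^T - B^T *m A *m primal_noise.

Lemma primal_witnessE w : primal_witness w =
  bS + (primal_noise *m w - (n%:R * lam) *: (invmx G *m zS)).
Proof. by rewrite /primal_witness mulmxBr -scalemxAr mulmxA. Qed.

Lemma dual_witnessE w : dual_witness w =
  dual_noise *m w + (n%:R * lam) *: (B^T *m A *m invmx G *m zS).
Proof.
rewrite /dual_witness primal_witnessE addrAC subrr add0r mulmxBl !mulmxBr.
by rewrite -!scalemxAr opprB !mulmxA addrA addrAC.
Qed.

Lemma norm_inf_mulmx_le m k (M : 'M[R]_(m, k)) (z : 'cV[R]_k) i :
  (forall l, `|z l 0| <= 1) -> `|(M *m z) i 0| <= norm_inf M.
Proof.
move=> z1; rewrite mxE.
apply: (@le_trans _ _ (\sum_j `|M i j|)); last first.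
  exact: (le_bigmax _ (fun i => \sum_j `|M i j|) i).
rewrite (le_trans (ler_norm_sum _ _ _))//; apply: ler_sum => l _.
by rewrite normrM ler_piMr.
Qed.

Let zS_le1 l : `|zS l 0| <= 1.
Proof. by rewrite mxE normr_sg; case: (_ != 0). Qed.

(** Half of the margin [rho] absorbs the shrinkage caused by the penalty, the
    other half the noise; off the support the irrepresentability condition
    leaves the fraction [eps] of the threshold for the noise. *)
Lemma sign_recovery_small_noise w (eps rho D : R) :
  norm_inf (B^T *m A *m invmx G) <= 1 - eps ->
  norm_inf (invmx (n%:R^-1 *: G)) <= D ->
  (forall k, rho <= `|bS k 0|) -> lam * D <= rho / 2 ->
  (forall k, `|(primal_noise *m w) k 0| < rho / 2) ->
  (forall j, `|(dual_noise *m w) j 0| <= n%:R * lam * eps) ->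
  sign_recovery X beta w lam.
Proof.
move=> irr GD brho lamD primal dual.
have n1 : n%:R != 0 :> R by rewrite pnatr_eq0 -lt0n.
have GE : invmx (n%:R^-1 *: G) = n%:R *: invmx G.
  by rewrite invmxZ ?invrK// unitmxZ// unitfE invr_eq0.
have nl0 : 0 <= n%:R * lam by rewrite mulr_ge0.
apply/sign_recoveryP; split=> [k|j]; last first.
  rewrite dual_witnessE mxE (le_trans (ler_normD _ _))//.
  rewrite [leRHS](_ : _ = n%:R * lam * eps + n%:R * lam * (1 - eps)); last by ring.
  rewrite lerD//.
  rewrite mxE normrM ger0_norm// ler_wpM2l//.
  exact: le_trans (norm_inf_mulmx_le _ _ zS_le1) irr.
have close : `|primal_witness w k 0 - bS k 0| < `|bS k 0|.
  have -> : primal_witness w k 0 - bS k 0 =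
      (primal_noise *m w) k 0 - lam * (invmx (n%:R^-1 *: G) *m zS) k 0.
    have ent (u v z : 'cV[R]_#|S|) c :
        (u + (v - c *: z)) k 0 - u k 0 = v k 0 - c * z k 0.
      by rewrite !mxE addrAC subrr add0r.
    have entZ (z : 'cV[R]_#|S|) c : (c *: z) k 0 = c * z k 0 by rewrite mxE.
    by rewrite primal_witnessE ent GE -scalemxAl entZ mulrA (mulrC lam).
  apply: (lt_le_trans _ (brho k)).
  apply: (le_lt_trans (ler_normB _ _)).
  rewrite [ltRHS](splitr rho) ltr_leD//; apply: le_trans lamD.
  rewrite normrM ger0_norm// ler_wpM2l//.
  exact: le_trans (norm_inf_mulmx_le _ _ zS_le1) GD.
have [b0|b0|b0] := ltrgt0P (bS k 0); last by have := bS_neq0 k; rewrite b0 eqxx.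
  rewrite gtr0_sg ?(gtr0_sg b0)//.
  by move: close; rewrite ltr_norml (gtr0_norm b0); lra.
rewrite ltr0_sg ?(ltr0_sg b0)//.
by move: close; rewrite ltr_norml (ltr0_norm b0); lra.
Qed.

Let sG : G^T = G.
Proof. by rewrite /G trmx_mul trmxK. Qed.

Lemma primal_noise_var k :
  \sum_i primal_noise k i ^+ 2 = invmx G k k.
Proof.
transitivity ((primal_noise *m primal_noise^T) k k).
  by rewrite [RHS]mxE; apply: eq_bigr => i _; rewrite [_^T _ _]mxE expr2.
rewrite /primal_noise trmx_mul trmxK trmx_inv sG.
by rewrite mulmxA -(mulmxA _ _ A) -/G mulVmx// mul1mx.
Qed.

(** The rows of [dual_noise] are the columns of [X] outside the support,
    projected orthogonally to the columns of [X] in the support; Pythagoras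
    shows that their norms do not increase. *)
Lemma dual_noise_var j :
  \sum_i dual_noise j i ^+ 2 <= sqnorm2 (col (enum_val j) X).
Proof.
(* [Q] is the orthogonal projection onto the span of the columns of [A]. *)
pose Q := A *m primal_noise.
have sQ : Q^T = Q by rewrite /Q /primal_noise !trmx_mul trmxK trmx_inv sG mulmxA.
have QQ : Q *m Q = Q.
  rewrite /Q {1}/primal_noise -!mulmxA (mulmxA A^T) -/G (mulmxA (invmx G)).
  by rewrite mulVmx// mul1mx.
have DE : dual_noise = B^T - B^T *m Q by rewrite /dual_noise /Q mulmxA.
pose x := row j B^T; pose y := x *m Q.
have -> : sqnorm2 (col (enum_val j) X) = sqnormr x.
  by apply: eq_bigr => i _; rewrite !mxE.
have -> : \sum_i dual_noise j i ^+ 2 = sqnormr (x - y).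
  apply: eq_bigr => i _; rewrite DE /y /x -row_mul.
  by rewrite !mxE.
suff -> : sqnormr x = sqnormr (x - y) + sqnormr y.
  by rewrite lerDl sqnormr_ge0.
have add00 (C E : 'M[R]_1) : (C + E) 0 0 = C 0 0 + E 0 0 by rewrite mxE.
have xy : y *m x^T = y *m y^T.
  have yT : y^T = Q *m x^T by rewrite trmx_mul sQ.
  by rewrite yT mulmxA -[y *m Q]mulmxA QQ.
have yx : x *m y^T = y *m y^T.
  by rewrite -[LHS]trmxK trmx_mul trmxK xy trmx_mul trmxK.
rewrite !sqnormrE -add00 linearB/= mulmxBl !mulmxBr xy yx subrr subr0 subrK.
by [].
Qed.

End primal_dual_witness.

(** * A non-asymptotic bound *)

Section finite_sample.
Context (R : realType) d (T : measurableType d) (P : probability T R).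

Lemma le_measure_bigsetU_fin (I : finType) (F : I -> set T) :
  (forall i, measurable (F i)) ->
  (P (\big[setU/set0]_i F i) <= \sum_i P (F i))%E.
Proof.
move=> mF.
suff [] : measurable (\big[setU/set0]_i F i) /\
    (P (\big[setU/set0]_i F i) <= \sum_i P (F i))%E by [].
elim/big_rec2 : _ => [|i m U _ [mU PU]]; first by rewrite measure0.
split; first exact: measurableU.
by apply: (le_trans (measureU2 _ (mF i) mU)); exact: leeD.
Qed.

Lemma mulmx_noise_vec n m (M : 'M[R]_(m, n)) (W : 'I_n -> {RV P >-> R}) t k :
  (M *m noise_vec W t) k 0 = linear_stat W (M k) t.
Proof. by rewrite mxE; apply: eq_bigr => i _; rewrite mxE. Qed.

Lemma gaussian_max_tail n m (M : 'M[R]_(m, n)) (W : 'I_n -> {RV P >-> R})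
    (sigma v u : R) :
  0 < sigma -> isotropic_gaussian sigma W -> 0 < v -> 0 < u ->
  (forall k, \sum_i M k i ^+ 2 <= v) ->
  measurable (\big[setU/set0]_k [set t | u <= `|(M *m noise_vec W t) k 0|]) /\
  (P (\big[setU/set0]_k [set t | (u <= `|(M *m noise_vec W t) k 0|)%R]) <=
   (2 * m%:R * expR (- (u ^+ 2 / (2 * sigma ^+ 2 * v))))%:E)%E.
Proof.
move=> s0 gW v0 u0 Mv.
have FE k : [set t | u <= `|(M *m noise_vec W t) k 0|] =
    [set t | u <= `|linear_stat W (M k) t|].
  by apply/seteqP; split => t /=; rewrite mulmx_noise_vec.
have mF k : measurable [set t | u <= `|(M *m noise_vec W t) k 0|].
  rewrite FE -[X in measurable X]setTI; apply: measurable_fun_le => //.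
  by apply: measurableT_comp => //; exact: measurable_linear_stat.
split; first exact: bigsetU_measurable.
rewrite (le_trans (le_measure_bigsetU_fin mF))//.
apply: (@le_trans _ _
    (\sum_(k < m) (2 * expR (- (u ^+ 2 / (2 * sigma ^+ 2 * v))))%:E)%E).
  by apply: lee_sum => k _; rewrite FE; exact: linear_stat_tail.
by rewrite sumEFin lee_fin sumr_const card_ord -[leLHS]mulr_natl mulrCA mulrA.
Qed.

Variables (n p : nat) (X : 'M[R]_(n, p)) (beta : 'cV[R]_p) (lam : R).
Variables (W : 'I_n -> {RV P >-> R}).
Let S := supp beta.
Let A := cols X S.
Let B := cols X (~: S)%SET.
Let G := A^T *m A.
Hypotheses (n0 : (0 < n)%N) (lam0 : 0 < lam) (uG : G \in unitmx).

(** The definition of the event involves an existential and a universal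
    quantifier over uncountable sets; its description by witnesses is a finite
    intersection of measurable conditions. *)
Lemma measurable_sign_recovery :
  measurable [set t | sign_recovery X beta (noise_vec W t) lam].
Proof.
have -> : [set t | sign_recovery X beta (noise_vec W t) lam] =
    (\bigcap_(k in [set: 'I_#|S|]) [set t |
       0 < subvec S beta k 0 * primal_witness X beta lam (noise_vec W t) k 0]) `&`
    (\bigcap_(j in [set: 'I_#|~: S|]) [set t |
       `|dual_witness X beta lam (noise_vec W t) j 0| <= n%:R * lam]).
  have sgE (b u : R) : b != 0 -> (Num.sg u = Num.sg b) <-> 0 < b * u.
    move=> b0; split=> [sg|].
      by rewrite -sgr_gt0 sgrM sg -expr2 lt_neqAle sqr_ge0 eq_sym sqrf_eq0 sgr_eq0 b0.
    move: b0; have [bp|bn|->] := ltrgt0P b; last by [].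
      by rewrite pmulr_rgt0// => _ up; rewrite !gtr0_sg.
    by rewrite nmulr_rgt0// => _ un; rewrite !ltr0_sg.
  have b0 k : subvec S beta k 0 != 0.
    by rewrite mxE; have := enum_valP k; rewrite inE.
  apply/seteqP; split => t /=.
    move=> /(sign_recoveryP n0 (ltW lam0) uG)[sg dual].
    by split=> i _ //=; apply/sgE.
  move=> [sg dual]; apply/(sign_recoveryP n0 (ltW lam0) uG).
  by split=> i; [apply/sgE => //; exact: sg|exact: dual].
have mlin m (M : 'M[R]_(m, n)) k c :
    measurable_fun setT (fun t => (M *m noise_vec W t) k 0 + c).
  apply: measurable_funD => //.
  under eq_fun do rewrite mulmx_noise_vec.
  exact: measurable_linear_stat.
apply: measurableI; apply: fin_bigcap_measurable => // k _.
  have mf : measurable_fun setT (fun t =>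
      subvec S beta k 0 * primal_witness X beta lam (noise_vec W t) k 0).
    apply: measurable_funM => //.
    have ent (u v z : 'cV[R]_#|S|) :
        (u + (v - z)) k 0 = v k 0 + (u k 0 - z k 0) by rewrite !mxE addrCA.
    under eq_fun do rewrite primal_witnessE ent.
    exact: mlin.
  have mle := measurable_fun_le measurableT mf (measurable_cst (0 : R)).
  rewrite setTI in mle; rewrite (_ : [set _ | _] = ~` [set t |
      subvec S beta k 0 * primal_witness X beta lam (noise_vec W t) k 0 <= 0]).
    exact: measurableC.
  by apply/seteqP; split => t /=; rewrite ltNge => /negP.
rewrite -[X in measurable X]setTI; apply: measurable_fun_le => //.
apply: measurableT_comp => //.
have ent (u v : 'cV[R]_#|~: S|) : (u + v) k 0 = u k 0 + v k 0 by rewrite mxE.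
under eq_fun do rewrite dual_witnessE ent.
exact: mlin.
Qed.

Variables (sigma eps rho Cmin : R).
Let D := norm_inf (invmx (n%:R^-1 *: G)).

(** The complement of the recovery event is covered by the events that some
    coordinate of the primal noise exceeds [rho / 2] or some coordinate of the
    dual noise exceeds [n * lam * eps]. *)
Lemma sign_recovery_prob :
  0 < sigma -> isotropic_gaussian sigma W ->
  (forall j, sqnorm2 (col j X) = n%:R) ->
  0 < eps -> norm_inf (B^T *m A *m invmx G) <= 1 - eps ->
  0 < Cmin -> Cmin <= Lambda_min (n%:R^-1 *: G) ->
  0 < rho -> (forall j, j \in S -> rho <= `|beta j 0|) -> lam * D <= rho / 2 ->
  (1 - (2 * #|S|%:R * expR (- (n%:R * rho ^+ 2 * (Cmin / (8 * sigma ^+ 2)))) +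
        2 * #|~: S|%:R *
          expR (- (n%:R * lam ^+ 2 * (eps ^+ 2 / (2 * sigma ^+ 2)))))%:E <=
   P [set t | sign_recovery X beta (noise_vec W t) lam])%E.
Proof.
move=> s0 gW colX eps0 irr C0 Cl rho0 brho lamD.
have n1 : 0 < n%:R :> R by rewrite ltr0n.
set E := [set t | _].
have mE : measurable E by exact: measurable_sign_recovery.
have varG k : \sum_i primal_noise X beta k i ^+ 2 <= (n%:R * Cmin)^-1.
  rewrite primal_noise_var//.
  have sG : (n%:R^-1 *: G)^T = n%:R^-1 *: G.
    by rewrite linearZ/= /G trmx_mul trmxK.
  have := invmx_diag_le sG C0 Cl k.
  rewrite invmxZ; last exact: (unitmx_Lambda_min sG C0 Cl).
  rewrite mxE (invrK (n%:R : R)) -/G => le_C.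
  by rewrite invfM mulrC ler_pdivlMr// mulrC.
have varD j : \sum_i dual_noise X beta j i ^+ 2 <= n%:R.
  by rewrite (le_trans (dual_noise_var _ _))// colX.
have v0 : 0 < (n%:R * Cmin)^-1 by rewrite invr_gt0 mulr_gt0.
have u0 : 0 < rho / 2 by rewrite divr_gt0.
have u0' : 0 < n%:R * lam * eps by rewrite !mulr_gt0.
have [mF1 PF1] := gaussian_max_tail s0 gW v0 u0 varG.
have [mF2 PF2] := gaussian_max_tail s0 gW n1 u0' varD.
set F1 := \big[setU/set0]_k _ in mF1 PF1.
set F2 := \big[setU/set0]_k _ in mF2 PF2.
have cover : ~` E `<=` F1 `|` F2.
  move=> t; apply: contra_notP => /not_orP[nF1 nF2].
  apply: (@sign_recovery_small_noise _ _ _ _ _ _ _ _ _ _ eps rho D) => //.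
  - exact: ltW.
  - by move=> k; rewrite mxE; apply: brho; exact: enum_valP.
  - move=> k; rewrite ltNge; apply/negP => kF; apply: nF1.
    by rewrite /F1 -bigcup_seq; exists k => //=; rewrite mem_index_enum.
  - move=> k; rewrite leNgt; apply/negP => /ltW kF; apply: nF2.
    by rewrite /F2 -bigcup_seq; exists k => //=; rewrite mem_index_enum.
have PC : (P (~` E) <= P F1 + P F2)%E.
  apply: le_trans (measureU2 _ mF1 mF2).
  by apply: le_measure => //; rewrite inE//; [exact: measurableC|exact: measurableU].
have -> : P E = (1 - P (~` E))%E.
  by rewrite -probability_setC ?setCK//; exact: measurableC.
apply: leeB => //; rewrite (le_trans PC)// EFinD; apply: leeD.
  apply: (le_trans PF1); rewrite lee_fin le_eqVlt; apply/orP; left; apply/eqP.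
  by congr (_ * expR (- _)); field; rewrite !gt_eqF.
apply: (le_trans PF2); rewrite lee_fin le_eqVlt; apply/orP; left; apply/eqP.
by congr (_ * expR (- _)); field; rewrite !gt_eqF.
Qed.

End finite_sample.

(** * Asymptotics *)

Section minimal_coefficient.
Context (R : realType) (p : nat).
Implicit Types b : 'cV[R]_p.

Lemma min_abs_le b j : j \in supp b -> min_abs b <= `|b j 0|.
Proof.
move=> jS; apply: ge_inf; last by exists j.
by exists 0 => _ [i _ <-].
Qed.

Lemma min_abs_gt0 b : (0 < #|supp b|)%N -> 0 < min_abs b.
Proof.
move=> /card_gt0P[j jS].
apply: (@lt_le_trans _ _ (\big[Num.min/1]_(i in supp b) `|b i 0|)).
  apply: lt_bigmin => // i; rewrite inE => bi.
  by rewrite normr_gt0.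
apply: lb_le_inf; first by exists `|b j 0|, j.
by move=> _ [i /= iS <-]; exact: bigmin_le_cond.
Qed.

End minimal_coefficient.

Section asymptotics.
Context (R : realType).

(** Already the diagonal entries of the inverse are at least 1: with x a column
    of X of squared norm n and a the corresponding row of G^-1 A^T, the product
    of a and x is 1 and |a|^2 = (G^-1)_kk, so that n (G^-1)_kk >= 1 by
    Cauchy-Schwarz, here in the form |x - n a|^2 >= 0. *)
Lemma norm_inf_invmx_ge1 n p (X : 'M[R]_(n, p)) (beta : 'cV[R]_p) :
  let A := cols X (supp beta) in
  let G := A^T *m A in
  (0 < n)%N -> (0 < #|supp beta|)%N -> G \in unitmx ->
  (forall j, sqnorm2 (col j X) = n%:R) ->
  1 <= norm_inf (invmx (n%:R^-1 *: G)).
Proof.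
move=> A G n0 s0 uG colX.
have n1 : 0 < n%:R :> R by rewrite ltr0n.
pose k := Ordinal s0.
pose a := primal_noise X beta k.
pose x i := X i (enum_val k).
have xx : \sum_i x i ^+ 2 = n%:R.
  by rewrite -(colX (enum_val k)); apply: eq_bigr => i _; rewrite !mxE.
have ax : \sum_i a i * x i = 1.
  transitivity ((invmx G *m G) k k); last by rewrite mulVmx// mxE eqxx.
  rewrite /G mulmxA [RHS]mxE; apply: eq_bigr => i _.
  by rewrite [X in _ = _ * X]mxE.
have : 0 <= \sum_i (x i - n%:R * a i) ^+ 2.
  by apply: sumr_ge0 => i _; exact: sqr_ge0.
have -> : \sum_i (x i - n%:R * a i) ^+ 2 =
    \sum_i x i ^+ 2 - 2 * n%:R * (\sum_i a i * x i) +
      n%:R ^+ 2 * \sum_i a i ^+ 2.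
  rewrite !mulr_sumr -sumrB -big_split; apply: eq_bigr => i _ /=.
  by ring.
rewrite xx ax primal_noise_var// -/A -/G => diag.
have {diag} : 1 <= n%:R * invmx G k k.
  rewrite -(ler_pM2l n1); nra.
move=> /le_trans; apply.
rewrite invmxZ; last by rewrite unitmxZ// unitfE invr_eq0 gt_eqF.
rewrite (invrK (n%:R : R)).
apply: le_trans (le_bigmax _ (fun i => \sum_j `|(n%:R *: invmx G) i j|) k).
have -> : n%:R * invmx G k k = (n%:R *: invmx G) k k by rewrite mxE.
rewrite (bigD1 k) ?inE//= (le_trans (ler_norm _))// lerDl.
by apply: sumr_ge0.
Qed.

Lemma card_expRN_le (N : nat) (x K : R) :
  ln N%:R + K <= x -> N%:R * expR (- x) <= expR (- K).
Proof.
case: N => [|N] h; first by rewrite mul0r expR_ge0.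
rewrite -[N.+1%:R](@lnK R) ?posrE// -expRD ler_expR; lra.
Qed.

Lemma ln_nat_ge0 (N : nat) : 0 <= ln N%:R :> R.
Proof.
case: N => [|N]; first by rewrite ln0.
by rewrite ln_ge0// ler1n.
Qed.

Lemma ln_nat_ge_ln2 (N : nat) : ln N%:R != 0 :> R -> ln 2 <= ln N%:R :> R.
Proof.
case: N => [|[|N]] lnN; last by rewrite ler_ln ?posrE// ler_nat.
  by move: lnN; rewrite [ln _]ln0 ?eqxx.
by move: lnN; rewrite [ln 1]ln1 eqxx.
Qed.

(** Hypothesis (a) in quantitative form, with [x] standing for n lam^2 and [N]
    for p - s.  A positive lower bound on the quotient forces ln N to be nonzero,
    hence at least ln 2; so a large quotient makes [x * c] exceed ln N by any
    constant, and makes [x] exceed 1. *)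
Lemma regularization_threshold (N : nat) (c K M x : R) : 0 < c ->
  (1 + `|K| / ln 2) / c <= M -> (ln 2)^-1 <= M -> M <= x / ln N%:R ->
  ln N%:R + K <= x * c /\ 1 <= x.
Proof.
move=> c0 M1 M2 Mx.
have l2 : 0 < ln 2 :> R by rewrite ln_gt0// ltr1n.
have M0 : 0 < M by rewrite (lt_le_trans _ M2)// invr_gt0.
have L0 : ln N%:R != 0 :> R.
  by apply/eqP => L0; move: Mx; rewrite L0 invr0 mulr0 leNgt M0.
have L2 := ln_nat_ge_ln2 L0.
have Lp : 0 < ln N%:R :> R by rewrite (lt_le_trans l2).
rewrite ler_pdivlMr// in Mx; rewrite ler_pdivrMr// in M1.
split; last first.
  apply: le_trans Mx; rewrite -[leLHS](mulVf (lt0r_neq0 l2)).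
  by rewrite ler_pM ?invr_ge0 ?(ltW l2).
have KL : `|K| <= `|K| / ln 2 * ln N%:R.
  by rewrite mulrAC ler_pdivlMr// ler_wpM2l.
have : (1 + `|K| / ln 2) * ln N%:R <= M * c * ln N%:R by rewrite ler_pM2r.
have : M * ln N%:R * c <= x * c by rewrite ler_pM2r.
have := ler_norm K; rewrite mulrDl mul1r; nra.
Qed.

(** Hypothesis (b) in quantitative form, with [N] standing for s, [x] for n lam^2
    and [lamD] for lam times the norm of (G / n)^-1.  Both n rho^2 >= M^2 ln N and, through
    [lamD], n rho^2 >= M^2 hold; half of each gives the bound by ln N plus a
    constant, also when ln N = 0. *)
Lemma signal_threshold (n N : nat) (c K M rho lamD x : R) :
  (0 < n)%N -> 0 < c -> 0 < rho -> 0 <= lamD -> 2 <= M ->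
  2 * (1 + `|K|) / c <= M -> 1 <= x -> x <= n%:R * lamD ^+ 2 ->
  rho^-1 * (Num.sqrt (ln N%:R / n%:R) + lamD) <= M^-1 ->
  ln N%:R + K <= n%:R * rho ^+ 2 * c /\ lamD <= rho / 2.
Proof.
move=> n0 c0 rho0 lD0 M2 MK x1 xD.
have n1 : 0 < n%:R :> R by rewrite ltr0n.
have M0 : 0 < M by lra.
have LN := ln_nat_ge0 N.
rewrite ler_pdivrMl// ler_pdivlMr// => sum_le.
have sq0 : 0 <= Num.sqrt (ln N%:R / n%:R) :> R by exact: sqrtr_ge0.
have Msq0 := mulr_ge0 (ltW M0) sq0; have MlD0 := mulr_ge0 (ltW M0) lD0.
have D_le : M * lamD <= rho by lra.
have S_le : M * Num.sqrt (ln N%:R / n%:R) <= rho by lra.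
split; last by rewrite ler_pdivlMr//; nra.
have S2 : M ^+ 2 * ln N%:R <= n%:R * rho ^+ 2.
  rewrite -ler_pdivrMl// mulrCA (mulrC _ (ln _)).
  rewrite -[X in _ * X](@sqr_sqrtr _ (ln N%:R / n%:R)) ?divr_ge0//.
  by rewrite -exprMn lerXn2r// nnegrE ?mulr_ge0// ltW.
have D2 : M ^+ 2 <= n%:R * rho ^+ 2.
  have : (M * lamD) ^+ 2 <= rho ^+ 2.
    by rewrite lerXn2r// nnegrE ?mulr_ge0// ltW.
  rewrite -(ler_pM2l n1) exprMn mulrCA => /(le_trans _); apply.
  by rewrite ler_peMr ?sqr_ge0// (le_trans x1).
have MM : 2 * (1 + `|K|) <= M ^+ 2 * c.
  move: MK; rewrite ler_pdivrMr// => MK; rewrite (le_trans MK)//.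
  by rewrite ler_pM2r// expr2 ler_peMr ?ltW//; lra.
have h1 : M ^+ 2 * ln N%:R * c <= n%:R * rho ^+ 2 * c by rewrite ler_pM2r.
have h2 : M ^+ 2 * c <= n%:R * rho ^+ 2 * c by rewrite ler_pM2r.
have h3 : 2 * (1 + `|K|) * (ln N%:R + 1) <= M ^+ 2 * c * (ln N%:R + 1).
  by rewrite ler_wpM2r// addr_ge0.
have h4 : 0 <= `|K| * ln N%:R by rewrite mulr_ge0.
have := ler_norm K; lra.
Qed.

Lemma cvg_probability1 (u : nat -> \bar R) :
  (\forall n \near \oo, (u n <= 1)%E) ->
  (forall e : R, 0 < e -> \forall n \near \oo, ((1 - e)%:E <= u n)%E) ->
  u @ \oo --> 1%E.
Proof.
move=> u1 ue.
have fin n e : (u n <= 1)%E -> ((1 - e)%:E <= u n)%E -> u n \is a fin_num.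
  move=> un1 en.
  by rewrite fin_numElt (lt_le_trans (ltNyr _) en) (le_lt_trans un1 (ltry _)).
apply/fine_cvgP; split.
  by near=> n; apply: (fin _ 1); near: n; [exact: u1|exact: ue].
apply/cvgrPdist_le => e e0; near=> n.
have un1 : (u n <= 1)%E by near: n; exact: u1.
have une : ((1 - e)%:E <= u n)%E by near: n; exact: ue.
have rE := fineK (fin _ _ un1 une).
move: un1 une; rewrite /= -rE; set r := fine (u n); rewrite /= !lee_fin => r1 er.
by rewrite ger0_norm ?subr_ge0//; lra.
Unshelve. all: by end_near. Qed.

End asymptotics.

(* The index 0 (no observation) is excluded from the pointwise hypotheses.
   In (a), [ln] is 0 at 0 and at 1 and division by 0 gives 0, so (a) entails
   p - s >= 2 for n large.  The eigenvalue hypothesis entails s >= 1. *)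
Theorem proposition1 (R : realType) (p : nat -> nat)
    (X : forall n, 'M[R]_(n, p n)) (beta : forall n, 'cV[R]_(p n))
    (d : nat -> measure_display) (T : forall n, measurableType (d n))
    (P : forall n, probability (T n) R)
    (W : forall n, 'I_n -> {RV (P n) >-> R})
    (sigma eps Cmin : R) (lam : nat -> R) :
  let S n := supp (beta n) in
  let s n := #|S n| in
  let XS n := cols (X n) (S n) in
  let XSc n := cols (X n) (~: S n)%SET in
  let gram n := (XS n)^T *m XS n in
  let rho n := min_abs (beta n) in
  0 < sigma ->
  0 < eps <= 1 ->
  0 < Cmin ->
  (forall n, (0 < n)%N -> forall j, sqnorm2 (col j (X n)) = n%:R) ->
  (forall n, (0 < n)%N -> isotropic_gaussian sigma (W n)) ->
  (forall n, (0 < n)%N ->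
     norm_inf ((XSc n)^T *m XS n *m invmx (gram n)) <= 1 - eps) ->
  (forall n, (0 < n)%N -> Cmin <= Lambda_min (n%:R^-1 *: gram n)) ->
  (forall n, (0 < n)%N -> 0 < lam n) ->
  lam n @[n --> \oo] --> 0 ->
  n%:R * lam n ^+ 2 / ln (p n - s n)%:R @[n --> \oo] --> +oo ->
  (rho n)^-1 * (Num.sqrt (ln (s n)%:R / n%:R) +
     lam n * norm_inf (invmx (n%:R^-1 *: gram n))) @[n --> \oo] --> 0 ->
  P n [set t | sign_recovery (X n) (beta n) (noise_vec (W n) t) (lam n)]
    @[n --> \oo] --> 1%E.
Proof.
move=> S s XS XSc gram rho s0 /andP[e0 _] C0 colX gW irr Cl lam0 _ lim_a lim_b.
pose D n := norm_inf (invmx (n%:R^-1 *: gram n)).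
have sG n : (n%:R^-1 *: gram n)^T = n%:R^-1 *: gram n.
  by rewrite linearZ/= /gram trmx_mul trmxK.
have n1 n : (0 < n)%N -> 0 < n%:R :> R by rewrite ltr0n.
have uG n : (0 < n)%N -> gram n \in unitmx.
  move=> n0; have := unitmx_Lambda_min (sG n) C0 (Cl n n0).
  by rewrite unitmxZ// unitfE invr_eq0 gt_eqF// n1.
have sp n : (0 < n)%N -> (0 < s n)%N.
  by move=> n0; exact: (size_gt0_Lambda_min C0 (Cl n n0)).
have D1 n : (0 < n)%N -> 1 <= D n.
  by move=> n0; apply: norm_inf_invmx_ge1 => //; [exact: sp|exact: uG|exact: colX].
have qE n : #|~: S n| = (p n - s n)%N by rewrite [LHS]cardsCs finset.setCK card_ord.
apply: cvg_probability1 => [|e e_gt0].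
  near=> n; have n0 : (0 < n)%N by near: n; exact: nbhs_infty_gt.
  apply: probability_le1; apply: measurable_sign_recovery => //; first exact: lam0.
  exact: uG.
(* Each of the two failure terms will be at most 2 exp(- K) = e / 2. *)
pose K := ln (4 / e).
pose c1 := Cmin / (8 * sigma ^+ 2).
pose c2 := eps ^+ 2 / (2 * sigma ^+ 2).
have c1_gt0 : 0 < c1 by rewrite divr_gt0 ?mulr_gt0 ?exprn_gt0.
have c2_gt0 : 0 < c2 by rewrite divr_gt0 ?mulr_gt0 ?exprn_gt0.
pose Ma := Num.max ((1 + `|K| / ln 2) / c2) (ln 2)^-1.
pose Mb := Num.max 2 (2 * (1 + `|K|) / c1).
have Mb0 : 0 < Mb by rewrite lt_max ltr0n.
near=> n.
have n0 : (0 < n)%N by near: n; exact: nbhs_infty_gt.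
have nR := n1 n n0.
have rho0 : 0 < rho n by apply: min_abs_gt0; exact: sp.
have big_a : Ma <= n%:R * lam n ^+ 2 / ln (p n - s n)%:R.
  by near: n; move/cvgryPge : lim_a; apply.
have small_b : (rho n)^-1 * (Num.sqrt (ln (s n)%:R / n%:R) + lam n * D n) <= Mb^-1.
  rewrite (le_trans (ler_norm _))//; near: n.
  by move/cvgr0_norm_le : lim_b; apply; rewrite invr_gt0.
have [dual_exp nlam1] : ln (p n - s n)%:R + K <= n%:R * lam n ^+ 2 * c2 /\
    1 <= n%:R * lam n ^+ 2.
  by apply: (regularization_threshold c2_gt0 _ _ big_a); rewrite le_max lexx ?orbT.
have nlamD : n%:R * lam n ^+ 2 <= n%:R * (lam n * D n) ^+ 2.
  rewrite ler_pM2l// exprMn ler_peMr ?sqr_ge0//.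
  by rewrite -[leLHS](expr1n _ 2) lerXn2r ?nnegrE ?(le_trans ler01)// D1.
have [primal_exp lamD] : ln (s n)%:R + K <= n%:R * rho n ^+ 2 * c1 /\
    lam n * D n <= rho n / 2.
  apply: (signal_threshold n0 c1_gt0 rho0 _ _ _ nlam1 nlamD small_b).
  - by rewrite mulr_ge0 ?ltW ?lam0// (lt_le_trans ltr01)// D1.
  - by rewrite le_max lexx.
  - by rewrite le_max lexx orbT.
have main := sign_recovery_prob n0 (lam0 n n0) (uG n n0) s0 (gW n n0)
  (colX n n0) e0 (irr n n0) C0 (Cl n n0) rho0 (@min_abs_le _ _ (beta n)) lamD.
apply: le_trans main.
rewrite -EFinB lee_fin lerD2l lerN2 qE.
have e_exp : expR (- K) = e / 4.
  by rewrite expRN lnK ?posrE ?divr_gt0// invf_div.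
have primal := card_expRN_le primal_exp.
have dual := card_expRN_le dual_exp.
rewrite e_exp in primal dual.
rewrite -!(mulrA 2) [leRHS](_ : e = 2 * (e / 4) + 2 * (e / 4)); last by field.
by rewrite lerD// ler_pM2l.
Unshelve. all: by end_near. Qed.
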